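(* Let $\mathfrak{R}$ be an elementary divisor domain that is not a field, with field of fractions $\mathbb{F}$. Let $A\in\mathfrak{R}^{n\times n}$, $B\in\mathfrak{R}^{n\times m}$, $C\in\mathfrak{R}^{p\times n}$ and $D\in\mathfrak{R}^{p\times m}$ with $\det A\neq 0$, and let $$P=\begin{bmatrix} A & B\\ C & D\end{bmatrix}\in\mathfrak{R}^{(n+p)\times (n+m)},\qquad G=D-CA^{-1}B\in\mathbb{F}^{p\times m}.$$ Let $S_G \doteq \operatorname{Diag}\left(\frac{\varepsilon_1}{\psi_1},\ldots, \frac{\varepsilon_r}{\psi_r}\right) \oplus 0_{(p-r) \times (m-r)}$ be the Smith-McMillan form of $G$ and $S_P \doteq \operatorname{Diag}( \widetilde{\varepsilon}_1 , \ldots , \widetilde{\varepsilon}_{n+r} ) \oplus 0_{(p-r) \times (m-r)}$ be the Smith form of $P$. (i) If $A$ and $B$ are not left coprime and $r = \operatorname{rank} G = p$ (that is, $G$ and $P$ have full row rank), then $\displaystyle \frac{\widetilde{\varepsilon}_1 \widetilde{\varepsilon}_2 \cdots \widetilde{\varepsilon}_{n+p}}{\varepsilon_1 \varepsilon_2 \cdots \varepsilon_p} \notin \mathfrak{R}^\times$. (ii) If $A$ and $C$ are not right coprime and $r = \operatorname{rank} G = m$ (that is, $G$ and $P$ have full column rank), then $\displaystyle \frac{\widetilde{\varepsilon}_1 \widetilde{\varepsilon}_2 \cdots \widetilde{\varepsilon}_{n+m}}{\varepsilon_1 \varepsilon_2 \cdots \varepsilon_m} \notin \mathfrak{R}^\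times$.
   Context: An elementary divisor domain (EDD) is an integral domain $\mathfrak{R}$ such that every $a,b,c\in\mathfrak{R}$ have a greatest common divisor which can be written $\gcd(a,b,c)=zxa+zyb+wyc$ for some $x,y,z,w\in\mathfrak{R}$; equivalently, an integral domain over which every matrix has a Smith form (defined below). $\mathfrak{R}^\times$ is the group of units. A square matrix over $\mathfrak{R}$ is unimodular if it is invertible over $\mathfrak{R}$. Two matrices $M,N$ of the same size over $\mathbb{F}$ are equivalent if $UMV=N$ with $U,V$ unimodular over $\mathfrak{R}$. Rank is rank over $\mathbb{F}$; one always has $\operatorname{rank}P=n+\operatorname{rank}G$. Smith form of $M\in\mathfrak{R}^{p\times m}$ of rank $r$: a matrix $\operatorname{Diag}(\alpha_1,\dots,\alpha_r)\oplus 0_{(p-r)\times(m-r)}$ equivalent to $M$ with all $\alpha_i\in\mathfrak R$ nonzero and $\alpha_1\mid\alpha_2\mid\cdots\mid\alpha_r$ (unique up to units). Smith-McMillan form of $G\in\mathbb{F}^{p\times m}$ of rank $r$: a matrix $\operatorname{Diag}(\varepsilon_1/\psi_1,\dots,\varepsilon_r/\psi_r)\oplus 0_{(p-r)\times(m-r)}$ equivalent to $G$, with nonzero $\varepsilon_i,\psi_i\in\mathfrak{R}$, $\varepsilon_1\mid\cdots\mid\varepsilon_r$, $\psi_r\mid\cdots\mid\psi_1$ and $\gcd(\varepsilon_i,\psi_i)\doteq 1$ (unique up to units). The symbol $\doteq$ means equality up to multiplication by a unit of $\mathfrak{R}$ (for scalars) or by a diagonal unimodular matrix (for matrices); ''the''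 Smith(-McMillan) form is understood up to $\doteq$, and its diagonal entries satisfy the stated divisibility chains. $G_1\in\mathfrak{R}^{p\times m}$ and $G_2\in\mathfrak{R}^{q\times m}$ are right coprime if every $F\in\mathfrak{R}^{m\times m}$ with $G_1=\widetilde G_1F$, $G_2=\widetilde G_2F$ for some matrices $\widetilde G_1,\widetilde G_2$ over $\mathfrak{R}$ is unimodular. $H_1,H_2$ (same number of rows) are left coprime if $H_1^T,H_2^T$ are right coprime. $\oplus$ denotes the block diagonal sum; $0_{0\times q}$ (resp. $0_{p\times 0}$) in a direct sum means appending $q$ zero columns (resp. $p$ zero rows). *)

(* Defs.v *)
From HB Require Import structures.
From mathcomp Require Import all_boot all_order all_algebra.

Set Implicit Arguments.
Unset Strict Implicit.
Unset Printing Implicit Defensive.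

Import GRing.Theory.
Local Open Scope ring_scope.

Notation "x %:F" := (@tofrac _ x) : ring_scope.

Section Divisibility.
Variable R : idomainType.
Implicit Types (a b c g d : R) (s : seq R).

Definition divides a b : Prop := exists c, b = c * a.

Definition is_gcd s g : Prop :=
  (forall a, a \in s -> divides g a) /\
  (forall d, (forall a, a \in s -> divides d a) -> divides d g).

End Divisibility.

Definition elementary_divisor_domain (R : idomainType) : Prop :=
  forall a b c : R, exists x y z w : R,
    is_gcd [:: a; b; c] (z * x * a + z * y * b + w * y * c).

Section Matrices.
Variable R : idomainType.
Local Notation F := {fraction R}.

Definition tofrac_mx p m (M : 'M[R]_(p, m)) : 'M[F]_(p, m) :=
  map_mx (@tofrac R) M.

(* Equivalence over F is by matrices unimodular over R, not over F. *)
Definition equivalent p m (M N : 'M[F]_(p, m)) : Prop :=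
  exists (U : 'M[R]_p) (V : 'M[R]_m),
    [/\ U \in unitmx, V \in unitmx & tofrac_mx U *m M *m tofrac_mx V = N].

(* Diag(s_1, ..., s_r) (+) 0_{(p-r) x (m-r)} with r = size s, used for
   r <= min(p, m); beyond its size, s`_i is 0. *)
Definition diag_sum0 (V : nmodType) p m (s : seq V) : 'M[V]_(p, m) :=
  \matrix_(i, j) (s`_i *+ (i == j :> nat)).

Definition smith_form p m (M : 'M[R]_(p, m)) r (alpha : r.-tuple R) : Prop :=
  [/\ \rank (tofrac_mx M) = r,
      forall i, (i < r)%N -> alpha`_i != 0,
      forall i, (i.+1 < r)%N -> divides alpha`_i alpha`_i.+1
    & equivalent (tofrac_mx M) (tofrac_mx (diag_sum0 p m alpha))].

Definition smith_mcmillan_form p m (G : 'M[F]_(p, m)) r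
    (eps psi : r.-tuple R) : Prop :=
  [/\ \rank G = r,
      forall i, (i < r)%N ->
        [/\ eps`_i != 0, psi`_i != 0 & is_gcd [:: eps`_i; psi`_i] 1],
      forall i, (i.+1 < r)%N -> divides eps`_i eps`_i.+1,
      forall i, (i.+1 < r)%N -> divides psi`_i.+1 psi`_i
    & equivalent G
        (diag_sum0 p m (mkseq (fun i => (eps`_i)%:F / (psi`_i)%:F) r))].

Definition right_coprime p q m (G1 : 'M[R]_(p, m)) (G2 : 'M[R]_(q, m)) : Prop :=
  forall X : 'M[R]_m,
    (exists H1 : 'M[R]_(p, m), G1 = H1 *m X) ->
    (exists H2 : 'M[R]_(q, m), G2 = H2 *m X) ->
    X \in unitmx.

Definition left_coprime n p q (H1 : 'M[R]_(n, p)) (H2 : 'M[R]_(n, q)) : Prop :=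
  right_coprime H1^T H2^T.

Definition transfer_function n m p (A : 'M[R]_n) (B : 'M[R]_(n, m))
    (C : 'M[R]_(p, n)) (D : 'M[R]_(p, m)) : 'M[F]_(p, m) :=
  tofrac_mx D - tofrac_mx C *m invmx (tofrac_mx A) *m tofrac_mx B.

(* x is in R^*, the units of R seen inside F. *)
Definition is_unit_of_R (x : F) : Prop :=
  exists2 u : R, u \is a GRing.unit & x = u%:F.

End Matrices.

(* Main.v *)
Require Import Defs.
From HB Require Import structures.
From mathcomp Require Import all_boot all_order all_algebra.

Set Implicit Arguments.
Unset Strict Implicit.
Unset Printing Implicit Defensive.

Import GRing.Theory.
Local Open Scope ring_scope.

(** If [P] has full row rank, the product of its invariant factors is, up to
    a unit, [det (P W)] for some [W] over [R].  For (i), suppose [A = X A1] and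
    [B = X B1]; then [P = (X (+) I) P1] and [P1] has the same transfer function
    as [P], so [det (P W) = det X * det (P1 W)].  It remains to see that
    [eps_1 ... eps_p] divides [det (P1 W)], for then the quotient in (i) is a
    multiple of [det X] and can only be a unit if [X] is unimodular.  With
    [u_i eps_i + v_i psi_i = 1], replacing (up to equivalence) the last [p]
    rows [(C D)] of [P1] by [u (C D) + v (0 I)] gives a matrix over [R] whose
    transfer function is [Diag(1 / psi_i)], and over the field of fractions
    [P1] is obtained from it by row operations of determinant
    [eps_1 ... eps_p].  Part (ii) is (i) for the transposed matrices. *)

(** With third argument 0 the defining gcd is a combination of [a] and [b] alone; being a common
    divisor it divides 1, and scaling by the cofactor gives the identity. *)
Lemma edd_bezout (R : idomainType) (a b : R) :
  elementary_divisor_domain R -> is_gcd [:: a; b] 1 ->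
  exists u v, u * a + v * b = 1.
Proof.
move=> /(_ a b 0) [x [y [z [w [dvd_g _]]]]] [_ max1].
have [d dvd_ab | c def1] := max1 (z * x * a + z * y * b + w * y * 0).
  by apply: dvd_g; move: dvd_ab; rewrite !inE => /orP[] ->; rewrite ?orbT.
exists (c * z * x), (c * z * y).
by rewrite def1 mulr0 addr0 mulrDr !mulrA.
Qed.

Lemma tofrac_mx_inj (R : idomainType) p m :
  injective (@tofrac_mx R p m).
Proof.
move=> M N /matrixP eqMN; apply/matrixP => i j.
by apply/eqP; move/eqP: (eqMN i j); rewrite !mxE tofrac_eq.
Qed.

Lemma tofrac_mxM (R : idomainType) k l p (M : 'M[R]_(k, l)) (N : 'M[R]_(l, p)) :
  tofrac_mx (M *m N) = tofrac_mx M *m tofrac_mx N.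
Proof. exact: map_mxM. Qed.

Lemma tofrac_mxD (R : idomainType) k l (M N : 'M[R]_(k, l)) :
  tofrac_mx (M + N) = tofrac_mx M + tofrac_mx N.
Proof. exact: map_mxD. Qed.

Lemma tofrac_unitmx (R : idomainType) n (M : 'M[R]_n) :
  \det M != 0 -> tofrac_mx M \in unitmx.
Proof. by move=> M_neq0; rewrite unitmxE det_map_mx unitfE tofrac_eq0. Qed.

(** This and the transposition lemmas below reduce part (ii) to part (i). *)
Lemma tr_diag_sum0 (V : nmodType) p m (s : seq V) :
  (diag_sum0 p m s)^T = diag_sum0 m p s.
Proof. by apply/matrixP=> i j; rewrite !mxE eq_sym; case: eqP => [->|]. Qed.

Lemma equivalent_tr (R : idomainType) p m (M N : 'M[{fraction R}]_(p, m)) :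
  equivalent M N -> equivalent M^T N^T.
Proof.
move=> [U [V [unitU unitV <-]]]; exists V^T, U^T.
by rewrite !unitmx_tr !trmx_mul mulmxA /tofrac_mx !map_trmx.
Qed.

Lemma smith_form_tr (R : idomainType) p m (M : 'M[R]_(p, m)) r
    (alpha : r.-tuple R) : smith_form M alpha -> smith_form M^T alpha.
Proof.
move=> [rkM alpha0 alpha_dvd /equivalent_tr eqM]; split=> //.
  by rewrite /tofrac_mx -map_trmx mxrank_tr.
by move: eqM; rewrite /tofrac_mx !map_trmx tr_diag_sum0.
Qed.

Lemma smith_mcmillan_form_tr (R : idomainType) p m
    (G : 'M[{fraction R}]_(p, m)) r (eps psi : r.-tuple R) :
  smith_mcmillan_form G eps psi -> smith_mcmillan_form G^T eps psi.
Proof.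
move=> [rkG cop eps_dvd psi_dvd /equivalent_tr eqG]; split=> //.
  by rewrite mxrank_tr.
by move: eqG; rewrite tr_diag_sum0.
Qed.

Lemma transfer_function_tr (R : idomainType) n m p (A : 'M[R]_n)
    (B : 'M[R]_(n, m)) (C : 'M[R]_(p, n)) (D : 'M[R]_(p, m)) :
  (transfer_function A B C D)^T = transfer_function A^T C^T B^T D^T.
Proof.
by rewrite /transfer_function linearB /= !trmx_mul trmx_inv mulmxA /tofrac_mx
           !map_trmx.
Qed.

Lemma schur_complement_lmul (K : fieldType) n m p (X A : 'M[K]_n)
    (B : 'M[K]_(n, m)) (C : 'M[K]_(p, n)) (D : 'M[K]_(p, m)) :
  X \in unitmx -> A \in unitmx ->
  D - C *m invmx (X *m A) *m (X *m B) = D - C *m invmx A *m B.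
Proof.
move=> uX uA; have uXA : X *m A \in unitmx by rewrite unitmx_mul uX.
congr (_ - _); rewrite -2!mulmxA; congr (_ *m _).
by apply: (can_inj (mulKmx uXA)); rewrite mulKVmx // -mulmxA mulKVmx.
Qed.

Lemma transfer_function_lmul (R : idomainType) n m p (X A : 'M[R]_n)
    (B : 'M[R]_(n, m)) (C : 'M[R]_(p, n)) (D : 'M[R]_(p, m)) :
  \det (X *m A) != 0 ->
  transfer_function (X *m A) (X *m B) C D = transfer_function A B C D.
Proof.
rewrite det_mulmx mulf_eq0 negb_or => /andP[X0 A0].
have uX := tofrac_unitmx X0; have uA := tofrac_unitmx A0.
rewrite /transfer_function !tofrac_mxM.
exact: (schur_complement_lmul (tofrac_mx B) (tofrac_mx C) (tofrac_mx D) uX uA).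
Qed.

Lemma smith_form_det (R : idomainType) k l (P : 'M[R]_(k, l))
    (alpha : k.-tuple R) :
  smith_form P alpha ->
  exists W : 'M[R]_(l, k), exists2 u : R, u \is a GRing.unit &
    \prod_(i < k) alpha`_i = u * \det (P *m W).
Proof.
move=> [rkP _ _ [U [V [unitU _ eqP]]]].
have le_kl : (k <= l)%N by rewrite -[X in (X <= _)%N]rkP rank_leq_col.
exists (V *m diag_sum0 l k (nseq k 1)), (\det U); first by rewrite -unitmxE.
rewrite -det_mulmx !mulmxA.
have -> : U *m P *m V = diag_sum0 k l alpha.
  by apply: tofrac_mx_inj; rewrite -eqP !tofrac_mxM.
rewrite (_ : _ *m _ = diag_mx (\row_i alpha`_i)).
  by rewrite det_diag; apply: eq_bigr => i _; rewrite mxE.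
apply/matrixP=> i j; rewrite !mxE (bigD1 (widen_ord le_kl i)) //= !mxE /=.
rewrite nth_nseq ltn_ord eqxx mulr1n mulr_natr big1 ?addr0 // => h ne_hi.
by rewrite !mxE eq_sym -(inj_eq val_inj) /= in ne_hi *; rewrite (negPf ne_hi) mul0r.
Qed.

(** Read from right to left: subtracting [du *m Z] times the top rows leaves [du *m S + N] as lower
    right block, [E] scales it to [S], and adding back [Z] times the top rows restores [C]. The
    outer factors have determinant 1, so only [\det E] remains. *)
Lemma scaled_schur_factorization (K : comRingType) n m p (A : 'M[K]_n)
    (B : 'M[K]_(n, m)) (C : 'M[K]_(p, n)) (S N : 'M[K]_(p, m))
    (Z : 'M[K]_(p, n)) (E du : 'M[K]_p) :
  Z *m A = C -> E *m (du *m S + N) = S ->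
  block_mx A B C (S + Z *m B) =
    block_mx 1%:M 0 Z 1%:M *m block_mx 1%:M 0 0 E
      *m block_mx 1%:M 0 (- (du *m Z)) 1%:M
      *m block_mx A B (du *m C) (du *m (S + Z *m B) + N).
Proof.
move=> defC defS; rewrite -!mulmxA !mulmx_block !mul1mx !mul0mx !addr0 !add0r.
rewrite !mulNmx -!(mulmxA du) defC addNr mulmx0 addr0 (mulmxDr du) -addrA.
by rewrite addrCA addKr defS addrC.
Qed.

Lemma smith_mcmillan_dvd_det (R : idomainType) n m p (A : 'M[R]_n)
    (B : 'M[R]_(n, m)) (C : 'M[R]_(p, n)) (D : 'M[R]_(p, m))
    (eps psi : p.-tuple R) (W : 'M[R]_(n + m, n + p)) :
  elementary_divisor_domain R -> \det A != 0 ->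
  smith_mcmillan_form (transfer_function A B C D) eps psi ->
  divides (\prod_(i < p) eps`_i) (\det (block_mx A B C D *m W)).
Proof.
move=> edd A0 [_ cop _ _ [U [V [unitU unitV eqG]]]].
have uA := tofrac_unitmx A0.
have /fin_all_exists[u /fin_all_exists[v uv1]] (i : 'I_p) :
    exists u v, u * eps`_i + v * psi`_i = 1.
  by have [_ _ /(edd_bezout edd)] := cop i (ltn_ord i).
pose du := diag_mx (\row_i u i); pose dv := diag_mx (\row_i v i).
pose J : 'M[R]_(p, m) := diag_sum0 p m (nseq p 1).
pose Q := block_mx A (B *m V) (du *m (U *m C)) (du *m (U *m D *m V) + dv *m J).
pose E := diag_mx (\row_(i < p) eps`_i).
pose Z := tofrac_mx (U *m C) *m invmx (tofrac_mx A).
pose S := tofrac_mx U *m transfer_function A B C D *m tofrac_mx V.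
have defS : S = tofrac_mx (U *m D *m V) - Z *m tofrac_mx (B *m V).
  rewrite /S /transfer_function /Z !tofrac_mxM mulmxBr mulmxBl.
  by rewrite !mulmxA.
have ZA : Z *m tofrac_mx A = tofrac_mx (U *m C) by rewrite mulmxKV.
(* On the diagonal, [u_i eps_i / psi_i + v_i = 1 / psi_i] by the Bezout relation, and multiplying by
   [eps_i] returns the entry of [S]. *)
have ET : tofrac_mx E *m (tofrac_mx du *m S + tofrac_mx (dv *m J)) = S.
  rewrite /S eqG /E /du /dv tofrac_mxM /tofrac_mx !map_diag_mx !mul_diag_mx.
  apply/matrixP=> i j; rewrite !mxE nth_nseq ltn_ord nth_mkseq //.
  case: eqP => _; rewrite ?mulr0n ?mulr1n ?rmorph0 ?rmorph1 ?mulr0 ?addr0 ?mulr0 //.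
  have [_ psi0 _] := cop i (ltn_ord i).
  have psiF0 : (psi`_i)%:F != 0 by rewrite tofrac_eq0.
  rewrite mulr1 -[X in _ + X](mulfK psiF0) mulrA -mulrDl -!rmorphM -rmorphD.
  by rewrite uv1 rmorph1 mulrA mulr1.
have defD : tofrac_mx (U *m D *m V) = S + Z *m tofrac_mx (B *m V).
  by rewrite defS subrK.
have rows := scaled_schur_factorization (tofrac_mx (B *m V)) ZA ET.
have defQ : tofrac_mx Q = block_mx (tofrac_mx A) (tofrac_mx (B *m V))
    (tofrac_mx du *m tofrac_mx (U *m C))
    (tofrac_mx du *m (S + Z *m tofrac_mx (B *m V)) + tofrac_mx (dv *m J)).
  rewrite /Q -defD -!tofrac_mxM -tofrac_mxD; exact: map_block_mx.
rewrite -defQ -defD -map_block_mx -/(tofrac_mx _) in rows.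
(* The row operations live over the fraction field, but both determinants lie in [R], so the
   identity descends by injectivity of the embedding. *)
have detE Y : \det (block_mx A (B *m V) (U *m C) (U *m D *m V) *m Y) =
    \det (Q *m Y) * \prod_(i < p) eps`_i.
  apply/eqP; rewrite -tofrac_eq -det_map_mx -/(tofrac_mx _) tofrac_mxM rows.
  rewrite -!mulmxA -tofrac_mxM !det_mulmx !(det_lblock, det_ublock) !det1.
  rewrite !mul1r !det_map_mx -rmorphM det_diag mulrC; apply/eqP.
  by congr (_ * _)%:F; apply: eq_bigr => i _; rewrite mxE.
(* [Vi] undoes the column operation [V]; it is absorbed into the arbitrary [W], whereas undoing [U]
   costs the unit [(\det U)^-1]. *)
pose Vi := block_mx 1%:M 0 0 (invmx V) : 'M[R]_(n + m).
exists ((\det U)^-1 * \det (Q *m (Vi *m W))).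
have -> : block_mx A B C D =
    block_mx 1%:M 0 0 (invmx U)
      *m block_mx A (B *m V) (U *m C) (U *m D *m V) *m Vi.
  rewrite /Vi !mulmx_block !mul1mx !mul0mx !mulmx0 !mulmx1 ?addr0 ?add0r.
  by rewrite -!mulmxA mulKmx // !mulmxV // !mulmx1 mulKmx // mulKmx.
rewrite -(mulmxA _ Vi W) -(mulmxA _ _ (Vi *m W)) det_mulmx det_ublock det1.
by rewrite mul1r det_inv detE mulrA.
Qed.

Lemma unit_quotient_left_coprime (R : idomainType) n m p (A : 'M[R]_n)
    (B : 'M[R]_(n, m)) (C : 'M[R]_(p, n)) (D : 'M[R]_(p, m))
    (eps psi : p.-tuple R) (epst : (n + p).-tuple R) :
  elementary_divisor_domain R -> \det A != 0 ->
  smith_mcmillan_form (transfer_function A B C D) eps psi ->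
  smith_form (block_mx A B C D) epst ->
  is_unit_of_R ((\prod_(i < n + p) epst`_i)%:F / (\prod_(i < p) eps`_i)%:F) ->
  left_coprime A B.
Proof.
move=> edd A0 SG /smith_form_det[W [u unit_u ->]] [w unit_w eq_w].
(* Coprimality is stated for the transposes, so the common left factor of [A] and [B] is [X^T]. *)
move=> X [A1 /(canRL trmxK) defA] [B1 /(canRL trmxK) defB].
rewrite !trmx_mul in defA defB.
have eps0 : \prod_(i < p) eps`_i != 0.
  by apply/prodf_neq0 => i _; have [_ /(_ i (ltn_ord i))[]] := SG.
have {}SG : smith_mcmillan_form (transfer_function A1^T B1^T C D) eps psi.
  by move: SG A0; rewrite defA defB => SG A0; rewrite transfer_function_lmul in SG.
have A1_0 : \det A1^T != 0.
  by move: A0; rewrite defA det_mulmx mulf_eq0 negb_or => /andP[].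
have [c defc] := smith_mcmillan_dvd_det W edd A1_0 SG.
have defP : block_mx A B C D =
    block_mx X^T 0 0 1%:M *m block_mx A1^T B1^T C D.
  by rewrite mulmx_block !mul1mx !mul0mx !addr0 !add0r -defA -defB.
have epsF0 : (\prod_(i < p) eps`_i)%:F != 0 by rewrite tofrac_eq0.
move/(canRL (mulfVK epsF0))/eqP: eq_w; rewrite -rmorphM tofrac_eq defP.
rewrite -mulmxA det_mulmx det_ublock det1 mulr1 det_tr defc !mulrA.
move=> /eqP/(mulIf eps0) def_w.
by move: unit_w; rewrite unitmxE -def_w !unitrM => /andP[/andP[_ ->]].
Qed.

Theorem theorem4p10 (R : idomainType)
    (R_edd : elementary_divisor_domain R) (R_notfield : ~ GRing.field_axiom R)
    (n m p r : nat)
    (A : 'M[R]_n) (B : 'M[R]_(n, m)) (C : 'M[R]_(p, n)) (D : 'M[R]_(p, m))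
    (detA : \det A != 0)
    (eps psi : r.-tuple R) (epst : (n + r).-tuple R)
    (SG : smith_mcmillan_form (transfer_function A B C D) eps psi)
    (SP : smith_form (block_mx A B C D) epst) :
  (~ left_coprime A B -> r = p ->
     ~ is_unit_of_R ((\prod_(i < n + p) epst`_i)%:F / (\prod_(i < p) eps`_i)%:F))
  /\
  (~ right_coprime A C -> r = m ->
     ~ is_unit_of_R ((\prod_(i < n + m) epst`_i)%:F / (\prod_(i < m) eps`_i)%:F)).
Proof.
split=> not_coprime def_r unit_q; apply: not_coprime; subst r.
  exact: unit_quotient_left_coprime SG SP unit_q.
(* Transposing the system exchanges [B] and [C], hence right and left coprimality. *)
rewrite -[A]trmxK -[C]trmxK -/(left_coprime A^T C^T).
move/smith_mcmillan_form_tr: SG; rewrite transfer_function_tr => SG.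
move/smith_form_tr: SP; rewrite tr_block_mx => SP.
apply: unit_quotient_left_coprime SG SP unit_q => //.
by rewrite det_tr.
Qed.
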